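(* Let $\mathcal{H}_1,\mathcal{H}_2$ be complex Hilbert spaces, and let $A_i\in\mathcal{B}(\mathcal{H}_i,\mathcal{H}_1)$ and $B_i\in\mathcal{B}(\mathcal{H}_1,\mathcal{H}_i)$ for $i=1,2$. Then $$r(A_1B_1+A_2B_2)\le\frac12\left(w(B_1A_1)+w(B_2A_2)\right)+\frac12\sqrt{\left(w(B_1A_1)-w(B_2A_2)\right)^2+3\|B_1A_2\|\,\|B_2A_1\|+w(B_2A_1B_1A_2)}.$$
   Context: $\mathcal{B}(\mathcal{H},\mathcal{K})$ is the space of bounded linear operators from $\mathcal{H}$ to $\mathcal{K}$. For a bounded operator $A$ on a complex Hilbert space $\mathcal{H}$, $r(A)$ is the spectral radius, $w(A)=\sup\{|\langle Ax,x\rangle|:\|x\|=1\}$ is the numerical radius, and $\|\cdot\|$ is the operator norm. *)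

(* Defs.v *)
From HB Require Import structures.
From mathcomp Require Import all_boot all_order all_algebra sesquilinear.
From mathcomp Require Import complex.
From mathcomp Require Import all_classical all_reals all_analysis.

Set Implicit Arguments.
Unset Strict Implicit.
Unset Printing Implicit Defensive.

Import Order.TTheory GRing.Theory Num.Theory.
Import numFieldNormedType.Exports.

Local Open Scope classical_set_scope.
Local Open Scope ring_scope.

(* Complex Hilbert spaces: the complex numbers are [R[i]] for [R : realType].
   Forms in [{dot H for Num.conj}] are positive definite, linear in the first
   argument and conjugate-linear in the second. *)
HB.mixin Record isHilbert (R : realType) H
    & CompleteNormedModule R[i] H := {
  inner : {dot H for (@Num.conj R[i])} ;
  inner_norm : forall x : H, `|x| ^+ 2 = inner x x
}.

#[short(type="hilbertType")]
HB.structure Definition Hilbert (R : realType) :=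
  {H of CompleteNormedModule R[i] H & isHilbert R H}.

(* The norm of a module over [R[i]] is [R[i]]-valued (with real values);
   [rnorm] is the same norm read in [R]. For [V := R[i]] it is the modulus. *)
Definition rnorm (R : realType) (V : normedZmodType R[i]) (x : V) : R :=
  complex.Re `|x|.

(* For a linear map this says that [`|f x| <= M * `|x|] for some [M], see
   [linear_boundedP]. *)
Definition bounded_op (R : realType) (H K : normedModType R[i]) (f : H -> K) :=
  bounded_near f (nbhs (0 : H)).

Definition opnorm (R : realType) (H K : normedModType R[i]) (f : H -> K) : R :=
  sup [set rnorm (f x) | x in [set x : H | rnorm x <= 1]].

(* On the zero space there is no unit vector and the value is [sup set0 = 0];
   likewise the spectrum is empty there and [spectral_radius] is [0]. *)
Definition numerical_radius (R : realType) (H : hilbertType R)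
    (f : H -> H) : R :=
  sup [set rnorm (inner (f x) x) | x in [set x : H | rnorm x = 1]].

Definition op_invertible (R : realType) (H : normedModType R[i])
    (f : H -> H) : Prop :=
  exists g : {linear H -> H}, [/\ bounded_op g, cancel f g & cancel g f].

Definition spectrum (R : realType) (H : normedModType R[i])
    (f : H -> H) : set R[i] :=
  [set l | ~ op_invertible (fun x => f x - l *: x)].

Definition spectral_radius (R : realType) (H : normedModType R[i])
    (f : H -> H) : R :=
  sup [set rnorm l | l in spectrum f].

(* Main.v *)
Require Import Defs.
From HB Require Import structures.
From mathcomp Require Import all_boot all_order all_algebra complex sesquilinear.
From mathcomp Require Import all_classical all_reals all_analysis.
From mathcomp Require Import ring lra.
Import Order.TTheory GRing.Theory Num.Theory.
Import numFieldNormedType.Exports.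
Local Open Scope ring_scope.
Local Open Scope classical_set_scope.
Local Open Scope complex_scope.
Set Implicit Arguments.
Unset Strict Implicit.
Unset Printing Implicit Defensive.

(** Fix a scalar l whose modulus exceeds the right-hand side; it suffices to
    invert l - (A1 B1 + A2 B2). This sum is the product of the row (A1 A2) and
    the column (B1 B2), so, l being nonzero, the operator is invertible as soon
    as l - T is, where T is the product in the other order, the operator matrix
    with rows (B1 A1, B1 A2) and (B2 A1, B2 A2) on H1 + H2. Write p, q for the
    numerical radii of the diagonal entries and B, C for the off-diagonal
    ones.

    The matrix l - T is inverted by elimination, which keeps everything on H1
    and H2. A bounded operator whose quadratic form, rotated by a fixed phase,
    has real part at least k |x|^2 with k > 0 is invertible
    ([coercive_invertible], the Lax-Milgram theorem in an elementary form,
    obtained from a contraction). As |l| > q this applies to l - B2 A2, with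
    inverse G say, and it remains to treat the Schur complement
    l - B1 A1 - B G C ([schur_invertible]).

    For x in H1 put y = G C x, beta = |<B y, x>| and gamma = |<C x, y>|.
    Coercivity of l - B2 A2 gives (|l| - q) |y|^2 <= gamma, and an inequality
    of Buzano type ([cross_terms]) gives
      2 beta gamma <= (|B| |C| + m) |x|^2 |y|^2,
    where m bounds the numerical range of C B. Eliminating gamma and y bounds
    beta by
      (|B| |C| + m) |x|^2 / (2 (|l| - q)). Hence the Schur complement is
    coercive once 2 |B| |C| + 2 m < 4 (|l| - p) (|l| - q). Both w(C B) and
    |B| |C| are admissible values of m; their mean turns the left-hand side
    into 3 |B| |C| + w(C B). By [quadratic_root_lt], this strict inequality,
    together with |l| > p and |l| > q, is what |l| exceeding the bound of the
    theorem means: the bound is the larger root of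
    4 (X - p) (X - q) = 3 |B| |C| + w(C B). *)

(** * Real-valued norms *)

Section RealNorm.
Context {R : realType}.
Implicit Types (V : normedModType R[i]) (a z : R[i]).

Lemma normr_rnorm (V : normedZmodType R[i]) (x : V) : `|x| = (rnorm x)%:C.
Proof. by rewrite /rnorm RRe_real ?normr_real. Qed.

Lemma rnorm_ge0 (V : normedZmodType R[i]) (x : V) : 0 <= rnorm x.
Proof. by rewrite -ler0c -normr_rnorm. Qed.

Lemma rnorm_lt (V : normedZmodType R[i]) (x : V) (e : R[i]) :
  0 <= e -> (`|x| < e) = (rnorm x < complex.Re e).
Proof. by move=> /ger0_real/RRe_real {1}<-; rewrite normr_rnorm ltcR. Qed.

Lemma rnorm0 (V : normedZmodType R[i]) : rnorm (0 : V) = 0.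
Proof. by rewrite /rnorm normr0. Qed.

Lemma rnorm_eq0 (V : normedZmodType R[i]) (x : V) : rnorm x = 0 -> x = 0.
Proof. by move=> x0; apply/eqP; rewrite -normr_eq0 normr_rnorm x0. Qed.

Lemma rnormN (V : normedZmodType R[i]) (x : V) : rnorm (- x) = rnorm x.
Proof. by rewrite /rnorm normrN. Qed.

Lemma ler_rnormD (V : normedZmodType R[i]) (x y : V) :
  rnorm (x + y) <= rnorm x + rnorm y.
Proof. by rewrite -lecR rmorphD /= -!normr_rnorm ler_normD. Qed.

Lemma rnormZ V a (x : V) : rnorm (a *: x) = rnorm a * rnorm x.
Proof. by apply: complexI; rewrite rmorphM /= -!normr_rnorm normrZ. Qed.

Lemma rnormM a z : rnorm (a * z) = rnorm a * rnorm z.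
Proof. exact: (rnormZ (V := R[i]^o)). Qed.

Lemma rnorm_real (r : R) : 0 <= r -> rnorm r%:C = r.
Proof. by move=> r0; rewrite /rnorm ger0_norm ?ler0c. Qed.

Lemma ler_Re_rnorm z : complex.Re z <= rnorm z.
Proof.
by apply: le_trans (ler_norm _) _; rewrite -lecR -normr_rnorm normc_ge_Re.
Qed.

Lemma rnorm_gt0 V (x : V) : x != 0 -> 0 < rnorm x.
Proof.
move=> xN0; rewrite lt_neqAle rnorm_ge0 andbT eq_sym.
by apply: contra_neq xN0; exact: rnorm_eq0.
Qed.

Lemma rnorm_normalize V (x : V) : x != 0 ->
  rnorm ((rnorm x)^-1%:C *: x) = 1.
Proof.
move=> xN0; rewrite rnormZ rnorm_real ?invr_ge0 ?rnorm_ge0// mulVf//.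
by apply: contra_neq xN0; exact: rnorm_eq0.
Qed.

Lemma conjC_real (r : R) : Num.conj (r%:C : R[i]) = r%:C.
Proof. by apply/CrealP; apply/complex_realP; exists r. Qed.

End RealNorm.

(** * Inner products *)

Section InnerProduct.
Context {R : realType} {H : hilbertType R}.
Implicit Types (x y z : H) (a : R[i]).

Lemma innerxx x : inner x x = (rnorm x ^+ 2)%:C.
Proof. by rewrite -inner_norm normr_rnorm rmorphXn. Qed.

Lemma inner_conj x y : inner x y = Num.conj (inner y x).
Proof. by rewrite hermC /= expr0 mul1r. Qed.

Lemma innerDl x y z : inner (x + y) z = inner x z + inner y z.
Proof. exact: linearDl. Qed.

Lemma innerBl x y z : inner (x - y) z = inner x z - inner y z.
Proof. exact: linearBl. Qed.

Lemma innerZl a x y : inner (a *: x) y = a * inner x y.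
Proof. exact: linearZl_LR. Qed.

Lemma innerZr a x y : inner x (a *: y) = Num.conj a * inner x y.
Proof. exact: linearZr_LR. Qed.

(** For a unit vector x the map y |-> 2 <y, x> x - y is the reflection fixing x
    and negating its orthogonal complement, hence an isometry. Scaling it by
    |x|^2 avoids normalizing x. *)
Lemma rnorm_reflection x y :
  rnorm (2 * inner y x *: x - inner x x *: y) = rnorm x ^+ 2 * rnorm y.
Proof.
set i := inner y x; set n := inner x x.
have nJ : Num.conj n = n by rewrite /n innerxx conjC_real.
have ix : inner x y = Num.conj i by rewrite inner_conj.
apply/eqP; rewrite -(@eqrXn2 _ 2) ?mulr_ge0 ?sqr_ge0 ?rnorm_ge0//.
apply/eqP/complexI; rewrite -innerxx exprMn rmorphM /= -innerxx rmorphXn /=.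
rewrite -innerxx dnormB !innerZl !innerZr ix -/n.
by rewrite !rmorphM /= !conjCK nJ rmorph_nat; ring.
Qed.

(** The vector 2 <y, x> x is the sum of |x|^2 y and of its image by the scaled
    reflection, which both have norm |x|^2 |y|. *)
Lemma cauchy_schwarz x y : rnorm (inner y x) <= rnorm y * rnorm x.
Proof.
have [x0|xN0] := eqVneq (rnorm x) 0.
  by rewrite x0 mulr0 (rnorm_eq0 x0) linear0r rnorm0.
have x_gt0 : 0 < rnorm x by rewrite lt_neqAle eq_sym xN0 rnorm_ge0.
have -> : rnorm (inner y x) = rnorm (2 * inner y x *: x) / (2 * rnorm x).
  rewrite rnormZ rnormM -[2]/(2%:R) -(rmorph_nat (real_complex R)).
  by rewrite rnorm_real ?ler0n//; field.
rewrite ler_pdivrMr ?mulr_gt0//.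
have := ler_rnormD (2 * inner y x *: x - inner x x *: y) (inner x x *: y).
rewrite subrK rnorm_reflection => /le_trans; apply.
by rewrite rnormZ innerxx rnorm_real ?sqr_ge0//; nra.
Qed.

Lemma sqr_rnormBZ x y (r : R) :
  rnorm (x - r%:C *: y) ^+ 2 =
  rnorm x ^+ 2 + r ^+ 2 * rnorm y ^+ 2 - 2 * r * complex.Re (inner y x).
Proof.
apply: complexI; rewrite -innerxx dnormB innerZl !innerZr conjC_real.
rewrite (inner_conj x y) !innerxx.
rewrite [Num.conj (_ * _)]rmorphM /= conjC_real conjCK.
have -> : Num.conj (inner y x) = (inner y x)^*%C by [].
rewrite -mulrDr [_^*%C + _]addrC addcJ.
by rewrite rmorphB rmorphD !rmorphM /= rmorph_nat; ring.
Qed.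

End InnerProduct.

(** * Bounded operators *)

Section BoundedOperators.
Context {R : realType}.
Implicit Types (U V W : normedModType R[i]).

Lemma bounded_opP V W (f : {linear V -> W}) :
  bounded_op f <-> exists M : R, forall x, rnorm (f x) <= M * rnorm x.
Proof.
rewrite /bounded_op linear_boundedP; split=> [/pinfty_ex_gt0[M M0 fM]|[M fM]].
  exists (complex.Re M) => x; rewrite -lecR rmorphM /= -!normr_rnorm.
  by rewrite RRe_real ?gtr0_real// fM.
near=> r => x; apply: (@le_trans _ _ (M%:C * `|x|)).
  by rewrite !normr_rnorm -rmorphM lecR.
rewrite ler_wpM2r//; near: r; apply: nbhs_pinfty_ge.
by apply/complex_realP; exists M.
Unshelve. all: by end_near. Qed.

Lemma bounded_op_ge0P V W (f : {linear V -> W}) : bounded_op f ->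
  exists2 M : R, 0 <= M & forall x, rnorm (f x) <= M * rnorm x.
Proof.
move=> /bounded_opP[M fM]; exists `|M| => // x.
by rewrite (le_trans (fM x))// ler_wpM2r ?rnorm_ge0// ler_norm.
Qed.

Lemma bounded_op_id V : bounded_op (idfun : V -> V).
Proof. by apply/bounded_opP; exists 1 => x; rewrite mul1r. Qed.

Lemma bounded_opD V W (f g : {linear V -> W}) :
  bounded_op f -> bounded_op g -> bounded_op (f \+ g).
Proof.
move=> /bounded_opP[M fM] /bounded_opP[N gN].
apply/(bounded_opP (f \+ g)); exists (M + N) => x /=.
by rewrite (le_trans (ler_rnormD _ _))// mulrDl lerD.
Qed.

Lemma bounded_opB V W (f g : {linear V -> W}) :
  bounded_op f -> bounded_op g -> bounded_op (f \- g).
Proof.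
move=> /bounded_opP[M fM] /bounded_opP[N gN].
apply/(bounded_opP (f \- g)); exists (M + N) => x /=.
by rewrite (le_trans (ler_rnormD _ _))// rnormN mulrDl lerD.
Qed.

Lemma bounded_opZ V W (a : R[i]) (f : {linear V -> W}) :
  bounded_op f -> bounded_op (a \*: f).
Proof.
move=> /bounded_opP[M fM]; apply/(bounded_opP (a \*: f)).
exists (rnorm a * M) => x /=.
by rewrite rnormZ -mulrA ler_wpM2l ?rnorm_ge0.
Qed.

Lemma bounded_op_comp U V W (f : {linear V -> W}) (g : {linear U -> V}) :
  bounded_op f -> bounded_op g -> bounded_op (f \o g).
Proof.
move=> /bounded_op_ge0P[M M0 fM] /bounded_opP[N gN].
apply/(bounded_opP (f \o g)); exists (M * N) => x /=.
by rewrite (le_trans (fM _))// -mulrA ler_wpM2l.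
Qed.

End BoundedOperators.

(** * Operator norm and numerical radius *)

Section NormsAsSuprema.
Context {R : realType}.

Lemma sup_ge0 (E : set R) : (forall r, E r -> 0 <= r) -> 0 <= sup E.
Proof.
move=> E_ge0; have [Esup|/sup_out->//] := pselect (has_sup E).
have [r Er] := Esup.1.
by apply: le_trans (E_ge0 r Er) _; apply: ub_le_sup Er; exact: Esup.2.
Qed.

Lemma opnorm_ge0 (V W : normedModType R[i]) (f : V -> W) : 0 <= opnorm f.
Proof. by apply: sup_ge0 => _ [x _ <-]; exact: rnorm_ge0. Qed.

Lemma numerical_radius_ge0 (H : hilbertType R) (f : H -> H) :
  0 <= numerical_radius f.
Proof. by apply: sup_ge0 => _ [x _ <-]; exact: rnorm_ge0. Qed.

(** Boundedness matters here: the supremum of an unbounded set is 0 by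
    convention. The same holds for [ler_numerical_radius]. *)
Lemma ler_opnorm (V W : normedModType R[i]) (f : {linear V -> W}) (x : V) :
  bounded_op f -> rnorm (f x) <= opnorm f * rnorm x.
Proof.
move=> /bounded_op_ge0P[M M0 fM].
have [->|xN0] := eqVneq x 0; first by rewrite linear0 !rnorm0 mulr0.
rewrite -ler_pdivrMr ?rnorm_gt0//; apply: ub_le_sup.
  exists M => _ [y /= y1 <-]; rewrite (le_trans (fM y))//.
  by rewrite -[leRHS]mulr1 ler_wpM2l.
exists ((rnorm x)^-1%:C *: x); first by rewrite /= rnorm_normalize.
by rewrite linearZ rnormZ rnorm_real ?invr_ge0 ?rnorm_ge0// mulrC.
Qed.

Lemma ler_numerical_radius (H : hilbertType R) (f : {linear H -> H}) (x : H) :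
  bounded_op f -> rnorm (inner (f x) x) <= numerical_radius f * rnorm x ^+ 2.
Proof.
move=> /bounded_op_ge0P[M M0 fM].
have [->|xN0] := eqVneq x 0.
  by rewrite linear0r !rnorm0 expr0n mulr0.
have x_gt0 := rnorm_gt0 xN0.
rewrite -ler_pdivrMr ?exprn_gt0//; apply: ub_le_sup.
  exists M => _ [y /= y1 <-]; rewrite (le_trans (cauchy_schwarz _ _))//.
  by rewrite y1 mulr1 (le_trans (fM y))// y1 mulr1.
exists ((rnorm x)^-1%:C *: x); first by rewrite /= rnorm_normalize.
rewrite [f _]linearZ innerZl innerZr conjC_real !rnormM.
by rewrite !rnorm_real ?invr_ge0 ?rnorm_ge0// expr2 invfM; ring.
Qed.

End NormsAsSuprema.

(** * Invertibility of coercive operators *)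

Section Coercive.
Context {R : realType}.

(** Banach's fixed point theorem for a complete space over the complex numbers:
    the iterates of 0 form a Cauchy sequence. *)
Lemma contraction_fixpoint (V : completeNormedModType R[i]) (F : V -> V)
    (q : R) : 0 <= q -> q < 1 ->
  (forall x y, rnorm (F x - F y) <= q * rnorm (x - y)) ->
  exists p, F p = p.
Proof.
move=> q0 q1 Fq; pose u n := iter n F 0; pose c := rnorm (u 1%N) / (1 - q).
have c_eq : q * c + rnorm (u 1%N) = c.
  by rewrite /c; field; rewrite gt_eqF// subr_gt0.
(* The ball of radius c around 0 is stable under F: this is the choice of c. *)
have u0 k : rnorm (u k - u 0) <= c.
  elim: k => [|k IHk].
    by rewrite subrr rnorm0 divr_ge0 ?rnorm_ge0// subr_ge0 ltW.
  rewrite -c_eq -[u k.+1 - _](subrKA (u 1%N)).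
  rewrite (le_trans (ler_rnormD _ _))// lerD ?subr0//.
  by rewrite (le_trans (Fq _ _))// ler_wpM2l.
have u_geo n k : rnorm (u (n + k)%N - u n) <= q ^+ n * c.
  elim: n => [|n IHn]; first by rewrite mul1r u0.
  by rewrite addSn (le_trans (Fq _ _))// exprS -mulrA ler_wpM2l.
have geo0 (e : R) : 0 < e -> exists n, q ^+ n * c < e.
  have q_lt1 : `|q| < 1 by rewrite ger0_norm.
  move=> e0; have /cvgr_lt/(_ e e0) := cvg_geometric c q_lt1.
  by move=> [n _ /(_ n (leqnn n))/=]; rewrite mulrC; exists n.
have u_cvg : cvgn u.
  apply/cauchy_cvgP; apply: cauchy_exP => e e0.
  have e0' : 0 < complex.Re e by move: e0; rewrite ltcE => /andP[].
  have [n qn] := geo0 _ e0'.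
  exists (u n); exists n => // m /= nm.
  rewrite -ball_normE /= distrC rnorm_lt ?ltW// (le_lt_trans _ qn)//.
  by rewrite -(subnKC nm).
exists (lim (u @ \oo)); set p := lim _.
apply/eqP; rewrite -subr_eq0; apply/eqP/rnorm_eq0/eqP.
rewrite eq_le rnorm_ge0 andbT; apply/ler_addgt0Pr => e e0; rewrite add0r.
have e2 : 0 < (e / 2)%:C :> R[i] by rewrite ltcR divr_gt0.
move/cvgrPdist_lt: u_cvg => /(_ _ e2)[N _ uN].
have := uN N.+1 (leqnSn N); have := uN N (leqnn N).
rewrite !(rnorm_lt _ (ltW e2)) -/p /= => pN pSN.
rewrite -(subrKA (u N.+1)) (le_trans (ler_rnormD _ _))// (splitr e) lerD//.
  by rewrite (le_trans (Fq _ _))//; nra.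
by rewrite -opprB rnormN ltW.
Qed.

(** The estimate makes L injective with closed range and bounded inverse, and
    L x = f is solved as a fixed point of x |-> x - rho u (L x - f): for small
    rho > 0, expanding the square norm shows that 1 - rho u L is a contraction,
    because the first-order term - 2 rho Re (u <L x, x>) dominates. No adjoint
    and no orthogonal projection is involved. *)
Lemma coercive_invertible (H : hilbertType R) (L : {linear H -> H})
    (u : R[i]) (k : R) :
  bounded_op L -> u != 0 -> 0 < k ->
  (forall x, k * rnorm x ^+ 2 <= complex.Re (u * inner (L x) x)) ->
  op_invertible L.
Proof.
move=> bL uN0 k0 coer.
have lower x : k * rnorm x <= rnorm u * rnorm (L x).
  have [->|xN0] := eqVneq x 0; first by rewrite linear0 !rnorm0 !mulr0.
  rewrite -(ler_pM2r (rnorm_gt0 xN0)) -mulrA -expr2 (le_trans (coer x))//.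
  rewrite (le_trans (ler_Re_rnorm _))// rnormM -mulrA.
  by rewrite ler_wpM2l ?rnorm_ge0 ?cauchy_schwarz.
have Linj : injective L.
  move=> x y Lxy; apply/eqP; rewrite -subr_eq0; apply/eqP/rnorm_eq0/eqP.
  rewrite eq_le rnorm_ge0 andbT -(ler_pM2l k0) mulr0.
  by rewrite (le_trans (lower _))// linearB Lxy subrr rnorm0 mulr0.
have Lsurj f : exists x, L x = f.
  have /bounded_op_ge0P[M M0 LM] := bounded_opZ u bL.
  (* Adding 1 makes the bound K on u L positive; rho = k / K^2 minimizes
     1 - 2 rho k + rho^2 K^2. *)
  pose K := M + 1; pose rho := k / K ^+ 2.
  have K0 : 0 < K by rewrite ltr_wpDl.
  have rho0 : 0 < rho by rewrite divr_gt0 ?exprn_gt0.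
  pose F x := x - rho%:C *: (u *: (L x - f)).
  have FB x y : F x - F y = (x - y) - rho%:C *: (u *: L (x - y)).
    rewrite /F; set a := L x - f; set b := L y - f.
    have -> : L (x - y) = a - b by rewrite linearB /a /b opprB addrA subrK.
    by rewrite !scalerBr !opprD !opprK addrACA.
  pose t := 1 - rho * k.
  have contr z : rnorm (z - rho%:C *: (u *: L z)) <= Num.sqrt t * rnorm z.
    have -> : Num.sqrt t * rnorm z = Num.sqrt (rnorm z ^+ 2 * t).
      by rewrite sqrtrM ?sqr_ge0// sqrtr_sqr ger0_norm ?rnorm_ge0// mulrC.
    rewrite -[leLHS]ger0_norm ?rnorm_ge0// -sqrtr_sqr ler_wsqrtr//.
    rewrite sqr_rnormBZ innerZl.
    have h1 := coer z.
    have h2 : rnorm (u *: L z) ^+ 2 <= K ^+ 2 * rnorm z ^+ 2.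
      rewrite -exprMn ler_pXn2r ?nnegrE ?mulr_ge0 ?rnorm_ge0 ?(ltW K0)//.
      by rewrite (le_trans (LM z))// ler_wpM2r ?rnorm_ge0// lerDl.
    have h3 : rho ^+ 2 * K ^+ 2 = rho * k.
      by rewrite /rho; field; rewrite gt_eqF.
    rewrite /t.
    have := ler_wpM2l (sqr_ge0 rho) h2; rewrite [leRHS]mulrA h3.
    have := ler_wpM2l (ltW rho0) h1.
    nra.
  have t1 : Num.sqrt t < 1.
    by rewrite -[X in _ < X]sqrtr1 ltr_sqrt// ltrBlDr ltrDl mulr_gt0.
  have FC x y : rnorm (F x - F y) <= Num.sqrt t * rnorm (x - y).
    by rewrite FB contr.
  have [p Fp] := contraction_fixpoint (sqrtr_ge0 t) t1 FC.
  exists p; apply/eqP; rewrite -subr_eq0; move/eqP: Fp.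
  rewrite -subr_eq0 addrC addKr oppr_eq0 !scaler_eq0 (negPf uN0).
  by rewrite eq_complex /= gt_eqF.
have [g gK] := choice Lsurj.
have g_lin : linear g.
  by move=> a x y; apply: Linj; rewrite linearP !gK.
pose G : {linear H -> H} := HB.pack g (GRing.isLinear.Build _ _ _ _ g g_lin).
exists G; split=> //.
  apply/bounded_opP; exists (rnorm u / k) => x /=.
  by rewrite mulrAC ler_pdivlMr// mulrC -[in leRHS](gK x) lower.
by move=> x; apply: Linj; rewrite gK.
Qed.

End Coercive.

(** * The product of the off-diagonal terms *)

Section Cross.
Context {R : realType} {H1 H2 : hilbertType R}.

(** Buzano's inequality for B y, x and C^* y, with the adjoint of C removed: the
    reflection z of B y in the line of x satisfies
    <C z, y> = 2 <B y, x> <C x, y> - |x|^2 <C B y, y>, while its norm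
    |x|^2 |B y| controls the left-hand side. *)
Lemma cross_terms (B : H2 -> H1) (C : {linear H1 -> H2}) (b c w : R) x y :
  rnorm (B y) <= b * rnorm y ->
  0 <= c -> (forall z, rnorm (C z) <= c * rnorm z) ->
  rnorm (inner (C (B y)) y) <= w * rnorm y ^+ 2 ->
  2 * rnorm (inner (B y) x) * rnorm (inner (C x) y) <=
    (b * c + w) * rnorm x ^+ 2 * rnorm y ^+ 2.
Proof.
move=> By c0 Cc CBy.
pose z := 2 * inner (B y) x *: x - inner x x *: B y.
have Cz : inner (C z) y =
    2 * inner (B y) x * inner (C x) y - inner x x * inner (C (B y)) y.
  by rewrite /z [C _]linearB ![C (_ *: _)]linearZ innerBl !innerZl.
have -> : 2 * rnorm (inner (B y) x) * rnorm (inner (C x) y) =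
    rnorm (inner (C z) y + inner x x * inner (C (B y)) y).
  rewrite Cz subrK !rnormM.
  by rewrite -[2 in RHS](rmorph_nat (real_complex R)) rnorm_real.
rewrite (le_trans (ler_rnormD _ _))// rnormM innerxx rnorm_real ?sqr_ge0//.
have h1 : rnorm (inner (C z) y) <= b * c * rnorm x ^+ 2 * rnorm y ^+ 2.
  rewrite (le_trans (cauchy_schwarz _ _))// [rnorm y ^+ 2]expr2 mulrA.
  rewrite ler_wpM2r ?rnorm_ge0// (le_trans (Cc _))// /z rnorm_reflection.
  have := ler_wpM2l (mulr_ge0 c0 (sqr_ge0 (rnorm x))) By.
  by lra.
have h2 := ler_wpM2l (sqr_ge0 (rnorm x)) CBy.
by rewrite [leRHS](_ : _ = b * c * rnorm x ^+ 2 * rnorm y ^+ 2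
  + rnorm x ^+ 2 * (w * rnorm y ^+ 2)) ?lerD//; ring.
Qed.

End Cross.

(** * Reduction to the Schur complement *)

Section Invert.
Context {R : realType}.

(** To solve A1 B1 v + A2 B2 v - l v = u, apply B1 and B2: the unknowns
    x = - B1 v and y = - B2 v solve the two-by-two system
    l x = B1 u + B1 A1 x + B1 A2 y and l y = B2 u + B2 A1 x + B2 A2 y.
    Eliminating y by means of G leaves the Schur complement for x, and then
    v = - (u + A1 x + A2 y) / l. In the proof these are the operators X, Y, I
    applied to u. *)
Lemma schur_invertible (V V1 V2 : normedModType R[i])
    (A1 : {linear V1 -> V}) (B1 : {linear V -> V1})
    (A2 : {linear V2 -> V}) (B2 : {linear V -> V2})
    (G : {linear V2 -> V2}) (l : R[i]) :
  bounded_op A1 -> bounded_op B1 -> bounded_op A2 -> bounded_op B2 ->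
  bounded_op G -> l != 0 ->
  cancel (fun y => l *: y - B2 (A2 y)) G ->
  cancel G (fun y => l *: y - B2 (A2 y)) ->
  op_invertible
    (fun x => l *: x - B1 (A1 x) - B1 (A2 (G (B2 (A1 x))))) ->
  op_invertible (fun u => ((A1 \o B1) \+ (A2 \o B2)) u - l *: u).
Proof.
move=> bA1 bB1 bA2 bB2 bG l0 GK KG [K [bK SK KS]].
pose X : {linear V -> V1} := K \o (B1 \+ (B1 \o A2 \o G \o B2)).
pose Y : {linear V -> V2} := G \o (B2 \+ (B2 \o A1 \o X)).
pose I : {linear V -> V} := - l^-1 \*: (idfun \+ ((A1 \o X) \+ (A2 \o Y))).
have bX : bounded_op X.
  apply: bounded_op_comp => //; apply: bounded_opD => //.
  by do 3![apply: bounded_op_comp => //].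
have bY : bounded_op Y.
  apply: bounded_op_comp => //; apply: bounded_opD => //.
  by do 2![apply: bounded_op_comp => //].
have bI : bounded_op I.
  apply: bounded_opZ; apply: bounded_opD; first exact: bounded_op_id.
  by apply: bounded_opD; apply: bounded_op_comp.
have XE u : X u = K (B1 u + B1 (A2 (G (B2 u)))) by [].
have YE u : Y u = G (B2 u + B2 (A1 (X u))) by [].
have IE u : I u = - l^-1 *: (u + (A1 (X u) + A2 (Y u))) by [].
exists I; split=> // u.
  set v := _ - _.
  have vE : v = A1 (B1 u) + A2 (B2 u) - l *: u by [].
  have GB2v : G (B2 v) = G (B2 (A1 (B1 u))) - B2 u.
    have B2v : B2 v = B2 (A1 (B1 u)) - (l *: B2 u - B2 (A2 (B2 u))).
      by rewrite vE linearB linearD [B2 (l *: _)]linearZ opprB addrA.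
    by rewrite B2v [G _]linearB (GK (B2 u)).
  have Xv : X v = - B1 u.
    rewrite XE; apply: (canLR SK); rewrite vE /= !linearN.
    rewrite GB2v !linearB !linearD [B1 (l *: _)]linearZ /= !opprK.
    set P := B1 (A1 _); set Q := B1 (A2 (B2 u)); set T := B1 (A2 (G _)).
    by rewrite addrA addrAC [P + Q]addrC -[Q + P - _]addrA [Q + _]addrC addrK
      [P - _]addrC.
  have Yv : Y v = - B2 u.
    rewrite YE Xv; apply: (canLR GK); rewrite vE /= !linearN.
    rewrite linearB linearD [B2 (l *: u)]linearZ /=.
    by rewrite addrAC [_ + B2 (A2 _)]addrC addrK opprK addrC.
  rewrite IE Xv Yv vE !linearN -opprD addrC addKr.
  by rewrite scaleNr scalerN opprK scalerA mulVf// scale1r.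
have Xu : l *: X u = B1 u + B1 (A1 (X u)) + B1 (A2 (Y u)).
  have /eqP := KS (B1 u + B1 (A2 (G (B2 u)))).
  rewrite -XE !subr_eq => /eqP ->; rewrite YE !linearD.
  by rewrite -!addrA; congr (_ + _); rewrite addrA addrC.
have Yu : l *: Y u = B2 u + B2 (A1 (X u)) + B2 (A2 (Y u)).
  by have /eqP := KG (B2 u + B2 (A1 (X u))); rewrite -YE subr_eq => /eqP.
have B1I : B1 (I u) = - X u.
  rewrite IE linearZ !linearD /= addrA -Xu.
  by rewrite scalerA mulNr mulVf// scaleN1r.
have B2I : B2 (I u) = - Y u.
  rewrite IE linearZ !linearD /= addrA -Yu.
  by rewrite scalerA mulNr mulVf// scaleN1r.
rewrite -[LHS]/(A1 (B1 (I u)) + A2 (B2 (I u)) - l *: I u) B1I B2I.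
rewrite [A1 _]linearN [A2 _]linearN -opprD.
by rewrite IE scalerA mulrN mulfV// scaleN1r opprK addrC addrK.
Qed.

End Invert.

(** * The larger root of the quadratic *)

Section Arith.
Context {R : realType}.

(** The left-hand side of the second hypothesis is the larger root of
    4 (X - p) (X - q) = D, which is at least max(p, q) as D >= 0. *)
Lemma quadratic_root_lt (l p q D : R) : 0 <= D ->
  2^-1 * (p + q) + 2^-1 * Num.sqrt ((p - q) ^+ 2 + D) < l ->
  [/\ p < l, q < l & D < 4 * (l - p) * (l - q)].
Proof.
move=> D0; set s := Num.sqrt _ => sl.
have s0 : 0 <= s by exact: sqrtr_ge0.
have s2 : s ^+ 2 = (p - q) ^+ 2 + D by rewrite sqr_sqrtr// addr_ge0 ?sqr_ge0.
have spq : `|p - q| <= s by rewrite -sqrtr_sqr ler_wsqrtr// lerDl.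
move: spq; rewrite ler_norml => /andP[sp sq].
split; [lra|lra|].
nra.
Qed.

End Arith.

(** * The resolvent outside the bound *)

Section Main.
Context {R : realType}.

(** Multiplication by this phase makes l positive, so that the real part in
    [coercive_invertible] sees the modulus of l. *)
Lemma exists_phase (l : R[i]) : l != 0 ->
  exists2 u, rnorm u = 1 & u * l = (rnorm l)%:C.
Proof.
move=> l0; exists (`|l| / l); last by rewrite divfK// normr_rnorm.
by rewrite /rnorm normf_div normr_id divff ?normr_eq0.
Qed.

Lemma phase_shift_ge (H : hilbertType R) (l u : R[i]) (x f : H) :
  rnorm u = 1 -> u * l = (rnorm l)%:C ->
  rnorm l * rnorm x ^+ 2 - rnorm (inner f x) <=
    complex.Re (u * inner (l *: x - f) x).
Proof.
move=> u1 ul; rewrite innerBl innerZl innerxx mulrBr.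
rewrite [u * (l * _)]mulrA ul -rmorphM.
rewrite raddfB /= lerD2l lerN2 (le_trans (ler_Re_rnorm _))//.
by rewrite rnormM u1 mul1r.
Qed.

(** The hypotheses bound beta gamma from above and gamma from below by
    multiples of Y^2, so Y and gamma cancel. When gamma = 0 nothing can be
    cancelled, but then Y = 0, and the crude bound on beta takes over. *)
Lemma schur_term_bound (X Y t b m beta gamma : R) :
  0 < t -> 0 <= m -> 0 <= gamma ->
  beta <= b * X * Y -> t * Y ^+ 2 <= gamma ->
  2 * beta * gamma <= m * X ^+ 2 * Y ^+ 2 ->
  2 * t * beta <= m * X ^+ 2.
Proof.
move=> t0 m0 g0 bXY tY bg.
have mX : 0 <= m * X ^+ 2 by rewrite mulr_ge0 ?sqr_ge0.
have [g_gt0|g_le0] := ltP 0 gamma.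
  rewrite -(ler_pM2r g_gt0).
  have := ler_wpM2l mX tY; have := ler_wpM2l (ltW t0) bg; lra.
have Y_eq0 : Y = 0.
  apply/eqP; rewrite -sqrf_eq0 eq_le sqr_ge0 andbT -(ler_pM2l t0) mulr0.
  exact: le_trans tY g_le0.
rewrite Y_eq0 mulr0 in bXY.
by apply: le_trans mX; rewrite mulr_ge0_le0// ?mulr_ge0 ?ltW.
Qed.

(** Coercivity of the Schur complement, through [cross_terms] and
    [schur_term_bound]. The space on which the sum acts is only reached
    through [schur_invertible], so it carries no inner product. *)
Lemma resolvent_outside_bound (V : normedModType R[i]) (H1 H2 : hilbertType R)
    (A1 : {linear H1 -> V}) (B1 : {linear V -> H1})
    (A2 : {linear H2 -> V}) (B2 : {linear V -> H2})
    (bA1 : bounded_op A1) (bB1 : bounded_op B1)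
    (bA2 : bounded_op A2) (bB2 : bounded_op B2) (l : R[i]) :
  let p := numerical_radius (B1 \o A1) in
  let q := numerical_radius (B2 \o A2) in
  p < rnorm l -> q < rnorm l ->
  3 * opnorm (B1 \o A2) * opnorm (B2 \o A1) +
    numerical_radius (B2 \o A1 \o B1 \o A2) <
    4 * (rnorm l - p) * (rnorm l - q) ->
  op_invertible (fun x => ((A1 \o B1) \+ (A2 \o B2)) x - l *: x).
Proof.
move=> p q pl ql.
set b := opnorm (B1 \o A2); set c := opnorm (B2 \o A1).
set w := numerical_radius (_ \o A2) => gap.
have p0 : 0 <= p := numerical_radius_ge0 _.
have w0 : 0 <= w := numerical_radius_ge0 _.
have b0 : 0 <= b := opnorm_ge0 _.
have c0 : 0 <= c := opnorm_ge0 _.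
have l0 : l != 0.
  by apply: contraTneq pl => ->; rewrite rnorm0 -leNgt.
have bA : bounded_op (B1 \o A1) by exact: bounded_op_comp.
have bB : bounded_op (B1 \o A2) by exact: bounded_op_comp.
have bC : bounded_op (B2 \o A1) by exact: bounded_op_comp.
have bD : bounded_op (B2 \o A2) by exact: bounded_op_comp.
have bCB : bounded_op (B2 \o A1 \o B1 \o A2).
  by do 3![apply: bounded_op_comp => //].
have Ap x : rnorm (inner (B1 (A1 x)) x) <= p * rnorm x ^+ 2.
  exact: (ler_numerical_radius _ bA).
have Dq y : rnorm (inner (B2 (A2 y)) y) <= q * rnorm y ^+ 2.
  exact: (ler_numerical_radius _ bD).
have Bb y : rnorm (B1 (A2 y)) <= b * rnorm y.
  exact: (ler_opnorm _ bB).
have Cc x : rnorm (B2 (A1 x)) <= c * rnorm x.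
  exact: (ler_opnorm _ bC).
(* The mean of two bounds for the numerical range, so that
   2 (b c + m) = 3 b c + w. *)
pose m := (w + b * c) / 2.
have CBm y : rnorm (inner (B2 (A1 (B1 (A2 y)))) y) <= m * rnorm y ^+ 2.
  have CBw := ler_numerical_radius y bCB.
  have CBbc : rnorm (inner (B2 (A1 (B1 (A2 y)))) y) <= b * c * rnorm y ^+ 2.
    rewrite (le_trans (cauchy_schwarz _ _))// [rnorm y ^+ 2]expr2 mulrA.
    rewrite ler_wpM2r ?rnorm_ge0// (le_trans (Cc _))//.
    by rewrite [b * c]mulrC -mulrA ler_wpM2l.
  by move: CBw CBbc; rewrite -/w /m /=; lra.
have [u u1 ul] := exists_phase l0.
have uN0 : u != 0.
  by apply: contra_eq_neq u1 => ->; rewrite rnorm0 eq_sym oner_eq0.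
have [G [bG GK KG]] : op_invertible ((l \*: idfun) \- (B2 \o A2)).
  apply: (@coercive_invertible _ _ _ u (rnorm l - q)) => //.
  - apply: bounded_opB => //; apply: bounded_opZ; exact: bounded_op_id.
  - by rewrite subr_gt0.
  move=> y; apply: le_trans (phase_shift_ge _ _ u1 ul).
  rewrite mulrBl lerD2l lerN2; exact: Dq.
apply: (schur_invertible bA1 bB1 bA2 bB2 bG l0 GK KG).
pose S : {linear H1 -> H1} :=
  ((l \*: idfun) \- (B1 \o A1)) \- (B1 \o A2 \o G \o B2 \o A1).
pose t := rnorm l - q; have t0 : 0 < t by rewrite subr_gt0.
pose k := rnorm l - p - (b * c + m) / (2 * t).
have k0 : 0 < k.
  rewrite subr_gt0 ltr_pdivrMr ?mulr_gt0//.
  by move: gap; rewrite /m /t; lra.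
apply: (@coercive_invertible _ _ S u k) => //.
  apply: bounded_opB; last by do 4![apply: bounded_op_comp => //].
  apply: bounded_opB => //; apply: bounded_opZ; exact: bounded_op_id.
move=> x; set y := G (B2 (A1 x)).
have Sx : S x = l *: x - (B1 (A1 x) + B1 (A2 y)) by rewrite opprD addrA.
rewrite Sx; apply: le_trans (phase_shift_ge _ _ u1 ul).
(* Coercivity of l - B2 A2 at y, whose image is C x. *)
have tY : t * rnorm y ^+ 2 <= rnorm (inner (B2 (A1 x)) y).
  have <- : l *: y - B2 (A2 y) = B2 (A1 x) by exact: KG.
  rewrite -[leRHS]mul1r -u1 -rnormM (le_trans _ (ler_Re_rnorm _))//.
  apply: le_trans (phase_shift_ge _ _ u1 ul).
  by rewrite /t mulrBl lerD2l lerN2.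
have By : rnorm (inner (B1 (A2 y)) x) <= b * rnorm x * rnorm y.
  rewrite (le_trans (cauchy_schwarz _ _))// mulrAC.
  by rewrite ler_wpM2r ?rnorm_ge0.
have cross :=
  @cross_terms _ _ _ (B1 \o A2) (B2 \o A1) b c m x y (Bb y) c0 Cc (CBm y).
have m0 : 0 <= b * c + m.
  by rewrite addr_ge0 ?divr_ge0 ?addr_ge0 ?mulr_ge0.
have := schur_term_bound t0 m0 (rnorm_ge0 _) By tY cross.
rewrite mulrC -ler_pdivlMr ?mulr_gt0// => By'.
rewrite /k !mulrBl -addrA lerD2l -opprD lerN2 innerDl.
rewrite (le_trans (ler_rnormD _ _))// lerD//.
by rewrite (le_trans By')// mulrAC.
Qed.

End Main.

Unset Implicit Arguments.

Theorem corollary1p6 (R : realType) (H1 H2 : hilbertType R)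
    (A1 : {linear H1 -> H1}) (B1 : {linear H1 -> H1})
    (A2 : {linear H2 -> H1}) (B2 : {linear H1 -> H2})
    (bA1 : bounded_op A1) (bB1 : bounded_op B1)
    (bA2 : bounded_op A2) (bB2 : bounded_op B2) :
  spectral_radius ((A1 \o B1) \+ (A2 \o B2)) <=
    2^-1 * (numerical_radius (B1 \o A1) + numerical_radius (B2 \o A2)) +
    2^-1 * Num.sqrt
      ((numerical_radius (B1 \o A1) - numerical_radius (B2 \o A2)) ^+ 2 +
       3 * opnorm (B1 \o A2) * opnorm (B2 \o A1) +
       numerical_radius (B2 \o A1 \o B1 \o A2)).
Proof.
rewrite -[_ ^+ 2 + _ + _]addrA.
set M := _ + 2^-1 * _; rewrite /spectral_radius.
have D0 : 0 <= 3 * opnorm (B1 \o A2) * opnorm (B2 \o A1) +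
    numerical_radius (B2 \o A1 \o B1 \o A2).
  by rewrite addr_ge0 ?mulr_ge0 ?opnorm_ge0 ?numerical_radius_ge0.
have M0 : 0 <= M.
  by rewrite addr_ge0 ?mulr_ge0 ?addr_ge0 ?sqrtr_ge0 ?numerical_radius_ge0.
set E := [set rnorm l | l in _].
(* An empty spectrum has spectral radius 0 by convention, which is harmless
   since M >= 0. *)
have [->|/set0P E0] := eqVneq E set0; first by rewrite sup0.
apply: ge_sup E0 _ => _ [l /= l_spec <-].
rewrite leNgt; apply/negP => /(quadratic_root_lt D0)[pl ql gap].
by apply: l_spec; exact: resolvent_outside_bound.
Qed.
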